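(* The class of unit-distance graphs is $(6,1)$-disjointness-expressing.
   Context: A unit-distance graph is a graph whose vertices are points in the plane, two points being adjacent iff their Euclidean distance equals 1. A class $\mathcal{C}$ of graphs is $(s,\kappa)$-disjointness-expressing if for some constant $\alpha>0$, for every positive integer $N$ and every $X\subseteq\{1,\dots,N\}$ one can define graphs $L(X)$ and $R(X)$, each containing a labelled set $S$ of special vertices, such that for all $A,B\subseteq\{1,\dots,N\}$: (i) the graph $g(L(A),R(B))$ obtained by identifying each vertex of $S$ in $L(A)$ with the corresponding vertex of $S$ in $R(B)$ is connected and has at most $\alpha N^{1/\kappa}$ vertices; (ii) the subgraph of $g(L(A),R(B))$ induced by the closed neighborhood $N[S]$ is independent of $A,B$ (for all $A,A',B,B'$ there is an isomorphism between these induced subgraphs that is the identity on $S$) and has at most $s$ vertices; (iii) $g(L(A),R(B))\in\mathcal{C}$ if and only if $A\cap B=\emptyset$. *)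

(* Defs.v *)
From HB Require Import structures.
From mathcomp Require Import all_boot all_order all_algebra.
From Stdlib Require Import Rdefinitions.
From Stdlib Require Import Rpower.
From mathcomp Require Import Rstruct.
Set Implicit Arguments. Unset Strict Implicit. Unset Printing Implicit Defensive.
Import Order.TTheory GRing.Theory Num.Theory.
Local Open Scope ring_scope.

(* A finite simple graph whose set S of special vertices is labelled by 'I_k
   (labelling injective). *)
Record lgraph (k : nat) := LGraph {
  lg_V : finType;
  lg_adj : rel lg_V;
  lg_sym : symmetric lg_adj;
  lg_irr : irreflexive lg_adj;
  lg_lab : 'I_k -> lg_V;
  lg_inj : injective lg_lab }.
Arguments lg_V {k} l.
Arguments lg_adj {k} l _ _.
Arguments lg_lab {k} l _.
Arguments lg_sym {k} l _ _.
Arguments lg_irr {k} l _.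
Arguments lg_inj {k} l _ _ _.

Definition glue_V k (L Rg : lgraph k) : finType :=
  (lg_V L + {v : lg_V Rg | v \notin codom (lg_lab Rg)})%type.

(* [rep x u] : vertex x of g(L,R) is the image of vertex u of R. *)
Definition glue_rep k (L Rg : lgraph k) (x : glue_V L Rg) (u : lg_V Rg) : bool :=
  match x with
  | inl a => [exists i, (a == lg_lab L i) && (u == lg_lab Rg i)]
  | inr w => val w == u
  end.

Definition glue_E k (L Rg : lgraph k) (x y : glue_V L Rg) : bool :=
  (match x, y with inl a, inl b => lg_adj L a b | _, _ => false end)
  || [exists u, exists v, [&& glue_rep x u, glue_rep y v & lg_adj Rg u v]].

(* union of the edges of L and R after identification (symmetrised /
   loops removed, which is harmless since L and R are simple graphs) *)
Definition glue_adj k (L Rg : lgraph k) : rel (glue_V L Rg) :=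
  fun x y => (x != y) && (glue_E x y || glue_E y x).

Lemma glue_sym k (L Rg : lgraph k) : symmetric (glue_adj (L:=L) (Rg:=Rg)).
Proof. by move=> x y; rewrite /glue_adj eq_sym orbC. Qed.

Lemma glue_irr k (L Rg : lgraph k) : irreflexive (glue_adj (L:=L) (Rg:=Rg)).
Proof. by move=> x; rewrite /glue_adj eqxx. Qed.

Definition glue_lab k (L Rg : lgraph k) (i : 'I_k) : glue_V L Rg := inl (lg_lab L i).

Lemma glue_inj k (L Rg : lgraph k) : injective (@glue_lab k L Rg).
Proof. by move=> i j [] /(lg_inj L). Qed.

Definition glue k (L Rg : lgraph k) : lgraph k :=
  @LGraph k (glue_V L Rg) (@glue_adj k L Rg) (@glue_sym k L Rg) (@glue_irr k L Rg)
    (@glue_lab k L Rg) (@glue_inj k L Rg).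

Definition connected k (G : lgraph k) : Prop :=
  forall x y : lg_V G, connect (lg_adj G) x y.

Definition closedNS k (G : lgraph k) : pred (lg_V G) :=
  [pred v | (v \in codom (lg_lab G)) || [exists i, lg_adj G v (lg_lab G i)]].

Arguments closedNS {k} G.

Definition NS_iso k (G1 G2 : lgraph k) : Prop :=
  exists f : {x : lg_V G1 | x \in closedNS G1} -> {y : lg_V G2 | y \in closedNS G2},
    [/\ bijective f,
        forall x y, lg_adj G1 (val x) (val y) = lg_adj G2 (val (f x)) (val (f y)) &
        forall i x, val x = lg_lab G1 i -> val (f x) = lg_lab G2 i].

Definition unit_distance k (G : lgraph k) : Prop :=
  exists p : lg_V G -> (R * R)%type,
    injective p /\
    forall x y, lg_adj G x y <->
      Num.sqrt (((p x).1 - (p y).1) ^+ 2 + ((p x).2 - (p y).2) ^+ 2) = 1.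

(* A class C of graphs (given as a predicate on graphs, invariant under the
   labelling) is (s,kappa)-disjointness-expressing.  {1,...,N} is represented
   by 'I_N. The number of special vertices may depend on N. *)
Definition disjointness_expressing (C : forall k, lgraph k -> Prop)
    (s kappa : nat) : Prop :=
  exists alpha : R, 0 < alpha /\
  exists (kS : nat -> nat)
         (L Rg : forall N : nat, {set 'I_N} -> lgraph (kS N)),
  forall N : nat, (0 < N)%nat ->
    [/\ (forall A B : {set 'I_N},
           connected (glue (L N A) (Rg N B)) /\
           (#|lg_V (glue (L N A) (Rg N B))|%:R <= alpha * Rpower N%:R (kappa%:R^-1))),
        (forall A B A' B' : {set 'I_N},
           NS_iso (glue (L N A) (Rg N B)) (glue (L N A') (Rg N B'))),
        (forall A B : {set 'I_N},
           (#|closedNS (glue (L N A) (Rg N B))| <= s)%nat) &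
        (forall A B : {set 'I_N},
           C _ (glue (L N A) (Rg N B)) <-> A :&: B = set0)].

(* Main.v *)
(* Both halves are induced subgraphs of the triangular lattice sharing a single
   edge S. Each half is a strip of triangles, hence rigid, and the two apexes
   over S must be distinct, so the halves lie on opposite sides of S and any
   unit-distance drawing of the glued graph is, up to congruence, the lattice
   drawing. An index i in A (resp. in B) adds a flag to the left (resp. right)
   half, at a position determined by i; two flags from different halves are at
   distance 1 exactly when they have the same index. As they are not adjacent, a
   common index makes a drawing impossible, while for disjoint A and B the
   lattice drawing is faithful. *)
Require Import Defs.
From Stdlib Require Import Rdefinitions Rpower.
From HB Require Import structures.
From mathcomp Require Import all_boot all_order all_algebra.
From mathcomp Require Import Rstruct.
From mathcomp Require Import zify ring lra.
Set Implicit Arguments. Unset Strict Implicit. Unset Printing Implicit Defensive.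
Import Order.TTheory GRing.Theory Num.Theory.
Local Open Scope ring_scope.

(** * The triangular lattice and its norm form *)

(* The pair (x, y) stands for the point x + y * exp(i * pi / 3) of the
   triangular lattice; norm_form is the square of its modulus. *)
Definition norm_form (d : int * int) : int := d.1 ^+ 2 + d.1 * d.2 + d.2 ^+ 2.

Definition lattice_adj : rel (int * int) := fun u v => norm_form (u - v) == 1.

Lemma norm_formN d : norm_form (- d) = norm_form d.
Proof. by rewrite /norm_form /=; ring. Qed.

Lemma lattice_adj_sym : symmetric lattice_adj.
Proof. by move=> u v; rewrite /lattice_adj -norm_formN opprB. Qed.

Lemma lattice_adj_irr : irreflexive lattice_adj.
Proof. by move=> u; rewrite /lattice_adj subrr. Qed.

Lemma norm_form_eq0 d : (norm_form d == 0) = (d == 0).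
Proof.
apply/idP/eqP => [|->//]; case: d => x y; rewrite /norm_form /= => /eqP h.
have hx : x = 0 by nia.
by rewrite hx in h *; congr pair; nia.
Qed.

(** Since [4 * norm_form (x, y) = (2x + y)^2 + 3y^2], and symmetrically in [x], both coordinates
    have absolute value at most 1. The solutions are the six units of the Eisenstein integers. *)
Lemma norm_form_eq1 (x y : int) : norm_form (x, y) = 1 ->
  (x, y) \in [:: (1, 0); (-1, 0); (0, 1); (0, -1); (1, -1); (-1, 1) : int * int].
Proof.
rewrite /norm_form /= => h.
have hx : -1 <= x <= 1 by apply/andP; split; nia.
have hy : -1 <= y <= 1 by apply/andP; split; nia.
rewrite !inE !xpair_eqE; nia.
Qed.

Lemma lattice_adjE u v : lattice_adj u v =
  (u - v \in [:: (1, 0); (-1, 0); (0, 1); (0, -1); (1, -1); (-1, 1)]).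
Proof.
rewrite /lattice_adj; case: (u - v) => x y; apply/eqP/idP; first exact: norm_form_eq1.
by rewrite !inE => /or4P[/eqP->|/eqP->|/eqP->|/or3P[]/eqP->].
Qed.

(** * Reflection of a unit triangle in one of its edges *)

Section Reflection.
Variable K : rcfType.
Implicit Types p q r : (K * K)%type.

Definition sqdist p q : K := (p.1 - q.1) ^+ 2 + (p.2 - q.2) ^+ 2.

Lemma sqrt_sqdist_eq1 p q : Num.sqrt (sqdist p q) = 1 <-> sqdist p q = 1.
Proof.
split=> [h|->]; last exact: sqrtr1.
have h0 : 0 <= sqdist p q by rewrite addr_ge0 ?sqr_ge0.
by rewrite -(sqr_sqrtr h0) h expr1n.
Qed.

(** The dot and cross products with a unit vector are the coordinates in an orthonormal frame. *)
Lemma dot_cross_eq0 (x y a b : K) : x ^+ 2 + y ^+ 2 = 1 ->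
  a * x + b * y = 0 -> a * y - b * x = 0 -> a = 0 /\ b = 0.
Proof.
move=> h d c; split.
- have -> : a = (a * x + b * y) * x + (a * y - b * x) * y - a * (x ^+ 2 + y ^+ 2 - 1) by ring.
  by rewrite d c h; ring.
- have -> : b = (a * x + b * y) * y - (a * y - b * x) * x - b * (x ^+ 2 + y ^+ 2 - 1) by ring.
  by rewrite d c h; ring.
Qed.

(** Seen from [p], the points [n] and [r] have the same dot product with [p - q], so by Lagrange's
    identity their cross products agree up to sign. Equal signs give [n = r], opposite signs the
    mirror image. *)
Lemma unit_triangle_reflection p q r n :
  sqdist p q = 1 -> sqdist r p = 1 -> sqdist r q = 1 ->
  sqdist n p = 1 -> sqdist n q = 1 -> n != r -> n = p + q - r.
Proof.
case: p q r n => [p1 p2] [q1 q2] [r1 r2] [n1 n2]; rewrite /sqdist /= => pq rp rq np nq nr.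
have dr : 2 * ((r1 - p1) * (p1 - q1) + (r2 - p2) * (p2 - q2)) = -1 by lra.
have dn : 2 * ((n1 - p1) * (p1 - q1) + (n2 - p2) * (p2 - q2)) = -1 by lra.
set x := p1 - q1 in pq dr dn; set y := p2 - q2 in pq dr dn.
set cr := (r1 - p1) * y - (r2 - p2) * x.
set cn := (n1 - p1) * y - (n2 - p2) * x.
have lagrange (a b : K) : (a * y - b * x) ^+ 2 =
    (a ^+ 2 + b ^+ 2) * (x ^+ 2 + y ^+ 2) - (a * x + b * y) ^+ 2 by ring.
have : (cn - cr) * (cn + cr) = 0.
  rewrite -subr_sqr !lagrange np rp.
  have -> : (n1 - p1) * x + (n2 - p2) * y = (r1 - p1) * x + (r2 - p2) * y by lra.
  by rewrite subrr.
move/eqP; rewrite mulf_eq0 => /orP[/eqP e|/eqP e].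
  have [||a b] := @dot_cross_eq0 x y (n1 - r1) (n2 - r2) pq.
  - by lra.
  - by rewrite -e /cn /cr; ring.
  by case/eqP: nr; congr pair; lra.
(* This vector is [(n - p) + (r - p) + (p - q)]: its dot product is -1/2 - 1/2 + 1 and its cross
   product is [cn + cr]. *)
have [||a b] := @dot_cross_eq0 x y (n1 - p1 - q1 + r1) (n2 - p2 - q2 + r2) pq.
- rewrite [LHS](_ : _ = ((n1 - p1) * x + (n2 - p2) * y) + ((r1 - p1) * x + (r2 - p2) * y)
     + (x ^+ 2 + y ^+ 2)); last by rewrite /x /y; ring.
  by lra.
- by rewrite -e /cn /cr /x /y; ring.
by congr pair => /=; lra.
Qed.

End Reflection.

(** * Rigidity of chains of unit triangles *)

Section Forced.
Variables (s : seq (int * int)) (c : int * int).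

(* Every unit-distance drawing of [s] sends a forced point to the place it has
   in the lattice spanned by the triangle (0, 0), (1, 0), [c]: a step reflects
   [w] in the edge [u v] of a unit triangle. *)
Inductive forced : int * int -> Prop :=
| Forced0 : forced (0, 0)
| Forced1 : forced (1, 0)
| ForcedApex : forced c
| ForcedStep w u v n : forced w -> forced u -> forced v ->
    lattice_adj w u -> lattice_adj w v -> lattice_adj u v ->
    n = u + v - w -> n != w -> n \in s -> forced n.

Hypotheses (s0 : (0, 0) \in s) (s1 : (1, 0) \in s) (sc : c \in s).

Lemma forced_mem v : forced v -> v \in s.
Proof. by case. Qed.

Lemma forced_step_adj w u v n : lattice_adj w u -> n = u + v - w -> lattice_adj n v.
Proof.
rewrite lattice_adj_sym /lattice_adj => h ->.
by rewrite addrAC addrK.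
Qed.

(** Affine maps preserve [u + v - w], and injectivity of [P] keeps the new triangle from folding
    back onto [w]. The vector [f] is constrained only through the apex [c], so one frame can serve
    both sides of the special edge. *)
Lemma forced_affine (K : rcfType) (P : int * int -> K * K) (e f : K * K) :
  {in s &, injective P} ->
  {in s &, forall u v, lattice_adj u v -> sqdist (P u) (P v) = 1} ->
  P (1, 0) = P (0, 0) + e -> P c = P (0, 0) + e *~ c.1 + f *~ c.2 ->
  forall v, forced v -> P v = P (0, 0) + e *~ v.1 + f *~ v.2.
Proof.
move=> Pinj Padj P1 Pc v; elim=> //=.
- by rewrite !mulr0z !addr0.
- by rewrite mulr1z mulr0z addr0.
move=> w u {}v n fw Pw fu Pu fv Pv wu wv uv en nw sn.
have [[mw mu] mv] := (forced_mem fw, forced_mem fu, forced_mem fv).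
have nv : lattice_adj n v := forced_step_adj wu en.
have nu : lattice_adj n u by apply: (forced_step_adj wv); rewrite en (addrC u).
rewrite (@unit_triangle_reflection K (P u) (P v) (P w) (P n)) ?Padj //.
  rewrite Pu Pv Pw en /= !mulrzBr !mulrzDr.
  by congr pair => /=; ring.
by apply: contra_neq nw => /Pinj; apply.
Qed.

End Forced.

(** * Induced lattice graphs containing the special edge *)

Definition base_edge : seq (int * int) := [:: (0, 0); (1, 0)].
Arguments base_edge : simpl never.

Section LatticeGraph.
Variable s : seq (int * int).

Let V := seq_sub (base_edge ++ s).

Lemma base_point_subproof (i : 'I_2) : ((i : nat)%:Z, 0) \in base_edge ++ s.
Proof. by case: i => [[|[|i]]]. Qed.

Definition base_point (i : 'I_2) : V := SeqSub (base_point_subproof i).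

Definition vertex_adj : rel V := fun u v => lattice_adj (val u) (val v).

Lemma vertex_adj_sym : symmetric vertex_adj.
Proof. by move=> u v; apply: lattice_adj_sym. Qed.

Lemma vertex_adj_irr : irreflexive vertex_adj.
Proof. by move=> u; apply: lattice_adj_irr. Qed.

Lemma base_point_inj : injective base_point.
Proof. by move=> i j /(congr1 (fst \o val)) [] /val_inj. Qed.

Definition lattice_graph : lgraph 2 :=
  LGraph vertex_adj_sym vertex_adj_irr base_point_inj.

Lemma base_pointP (v : V) : (v \in codom base_point) = (val v \in base_edge).
Proof.
apply/codomP/idP => [[i ->]|]; first by case: i => [[|[|]]].
by rewrite !inE => /orP[] /eqP e; [exists ord0 | exists ord_max]; apply: val_inj.
Qed.

Lemma card_lattice_graph : (#|lg_V lattice_graph| <= (size s).+2)%N.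
Proof.
rewrite -[(_ s).+2](size_map id (base_edge ++ s)) map_id.
rewrite cardE -(size_map val); apply: uniq_leq_size.
  by rewrite map_inj_uniq ?enum_uniq //; apply: val_inj.
by move=> _ /mapP[v _ ->]; apply: valP.
Qed.

End LatticeGraph.

(** * Lattice coordinates on the glued graph *)

Section Glue.
Variables s t : seq (int * int).

Notation G := (glue (lattice_graph s) (lattice_graph t)).

(* The two special vertices are [inl] vertices of the gluing, hence have key
   [(true, _)] although they belong to both sides. *)
Definition key (x : lg_V G) : bool * (int * int) :=
  match x with inl v => (true, val v) | inr w => (false, val (val w)) end.

Lemma key_inj : injective key.
Proof.
move=> [v|w] [v'|w'] //= [].
  by move/val_inj->.
by move=> /val_inj/val_inj->.
Qed.

Definition side_points (b : bool) := if b then s else t.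

Lemma key_mem x : (key x).2 \in base_edge ++ side_points (key x).1.
Proof. by case: x => [v|w] /=; apply: valP. Qed.

Lemma key_right x : ~~ (key x).1 -> (key x).2 \notin base_edge.
Proof. by case: x => [v|[w /= h]] //= _; move: h; rewrite base_pointP. Qed.

(** The conditional matters only for keys on different sides, where it selects the left point; an
    edge across requires that point to be special. *)
Definition key_adj : rel (bool * (int * int)) := fun k l =>
  lattice_adj k.2 l.2 &&
  ((k.1 == l.1) || ((if k.1 then k.2 else l.2) \in base_edge)).

Lemma glue_repE (x : lg_V G) (u : lg_V (lattice_graph t)) :
  glue_rep x u = (((key x).2 \in base_edge) || ~~ (key x).1) && (val u == (key x).2).
Proof.
case: x => [v|w] /=; last by rewrite orbT /= eq_sym.
rewrite orbF; apply/existsP/andP => [[i /andP[/eqP-> /eqP->]]|[h /eqP e]].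
  by split; case: i => [[|[|]]].
move: h; rewrite -base_pointP => /codomP[i vi]; exists i.
by rewrite vi eqxx; apply/eqP/val_inj; apply: etrans e (congr1 val vi).
Qed.

Lemma glue_adj_key x y : lg_adj G x y = key_adj (key x) (key y).
Proof.
have repP z : ((key z).2 \in base_edge) || ~~ (key z).1 ->
    (key z).2 \in base_edge ++ t.
  by rewrite mem_cat; have := key_mem z; rewrite mem_cat; case: (key z) => [[] v] //= _ /orP[->|].
have glueE u v : glue_E u v = lattice_adj (key u).2 (key v).2 &&
    ((key u).1 && (key v).1 || (((key u).2 \in base_edge) || ~~ (key u).1)
      && (((key v).2 \in base_edge) || ~~ (key v).1)).
  rewrite /glue_E andb_orr; congr (_ || _).
    by case: u v => [u|u] [v|v] //=; rewrite ?andbF ?andbT.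
  apply/existsP/andP => [[u' /existsP[v']]|[uv /andP[ru rv]]].
    by rewrite !glue_repE => /and3P[/andP[-> /eqP<-] /andP[-> /eqP<-]].
  exists (SeqSub (repP _ ru)); apply/existsP; exists (SeqSub (repP _ rv)).
  by rewrite !glue_repE ru rv !eqxx.
rewrite /= /glue_adj !glueE (lattice_adj_sym (key y).2) /key_adj.
case: (boolP (lattice_adj _ _)) => [h|_]; last by rewrite andbF.
have -> : x != y by apply: contraTneq h => ->; rewrite lattice_adj_irr.
by case: (key x) (key y) => [[] u] [[] v] //=; rewrite ?orbT ?orbF ?andbT // orbb.
Qed.

Lemma key_ex (b : bool) v : v \in base_edge ++ side_points b ->
  exists x, key x == (b || (v \in base_edge), v).
Proof.
case: (boolP (v \in base_edge)) => [vb _|vb].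
  have vs : v \in base_edge ++ s by rewrite mem_cat vb.
  by exists (inl (SeqSub vs)); rewrite orbT.
case: b => vs; first by exists (inl (SeqSub vs)).
have nv : (SeqSub vs) \notin codom (lg_lab (lattice_graph t)) by rewrite base_pointP.
by exists (inr (exist _ (SeqSub vs) nv)).
Qed.

(** Inverse to [key], with special points sent to their left key from either side. The default is
    reached only when [v] is not a point of side [b]. *)
Definition vertex b v : lg_V G :=
  odflt (lg_lab G ord0) [pick x | key x == (b || (v \in base_edge), v)].

Lemma key_vertex b v : v \in base_edge ++ side_points b ->
  key (vertex b v) = (b || (v \in base_edge), v).
Proof.
rewrite /vertex => /key_ex[x kx]; case: pickP => [y /eqP //|/(_ x)].
by rewrite kx.
Qed.

Lemma vertex_key x : vertex (key x).1 (key x).2 = x.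
Proof.
apply: key_inj; rewrite key_vertex ?key_mem //.
have := @key_right x; case: (key x) => [[] v] //= /(_ isT).
by move/negPf->.
Qed.

Lemma vertex_adj_lattice b : {in base_edge ++ side_points b &, forall u v,
  lattice_adj u v -> lg_adj G (vertex b u) (vertex b v)}.
Proof.
move=> u v mu mv uv; rewrite glue_adj_key !key_vertex // /key_adj /= uv.
by case: b {mu mv} => //=; case: ifP => [->|_]; [rewrite orbT | case: (v \in _)].
Qed.

Lemma vertex_inj b : {in base_edge ++ side_points b &, injective (vertex b)}.
Proof. by move=> u v mu mv /(congr1 key); rewrite !key_vertex // => -[]. Qed.

Lemma vertex_base b v : v \in base_edge -> vertex b v = vertex true v.
Proof.
move=> h; apply: key_inj.
by rewrite !key_vertex ?mem_cat ?h ?orbT.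
Qed.

(** Each forced point is adjacent to an earlier one, so paths lead back to [(0, 0)], which both
    sides share. *)
Lemma glue_connected (c : bool -> int * int) :
  (forall b, c b \in side_points b) ->
  (forall b, lattice_adj (0, 0) (c b)) ->
  (forall b v, v \in side_points b -> forced (base_edge ++ side_points b) (c b) v) ->
  connected G.
Proof.
move=> cs c0 cf.
have symG : connect_sym (lg_adj G) by apply/sym_connect_sym/lg_sym.
suff h x : connect (lg_adj G) (vertex true (0, 0)) x.
  by move=> x y; rewrite (connect_trans _ (h y)) // symG.
rewrite -(vertex_key x) -(@vertex_base (key x).1) //.
have m0 b : (0, 0) \in base_edge ++ side_points b by [].
set b := (key x).1.
have {cf} fx : forced (base_edge ++ side_points b) (c b) (key x).2.
  have := key_mem x; rewrite mem_cat => /orP[|/cf //].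
  by rewrite !inE => /orP[] /eqP ->; [apply: Forced0 | apply: Forced1].
have mc : c b \in base_edge ++ side_points b by rewrite mem_cat cs orbT.
elim: fx => //; try by move=> *; apply/connect1/vertex_adj_lattice.
move=> w u v n _ _ fu cu fv cv wu wv uv en nw sn.
apply: connect_trans cu _; apply/connect1/vertex_adj_lattice => //.
  by apply: forced_mem fu.
rewrite lattice_adj_sym; apply: (forced_step_adj wv).
by rewrite en (addrC u).
Qed.

Lemma card_glue : (#|lg_V G| <= size s + size t + 4)%N.
Proof.
rewrite card_sum card_sig.
apply: leq_trans (leq_add (card_lattice_graph s) (max_card _)) _.
apply: leq_trans (leq_add (leqnn _) (card_lattice_graph t)) _.
by lia.
Qed.

End Glue.

Lemma key_bijection (T1 T2 : finType) (K : eqType) (k1 : T1 -> K) (k2 : T2 -> K) :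
  injective k1 -> injective k2 ->
  (forall x, exists y, k2 y == k1 x) -> (forall y, exists x, k1 x == k2 y) ->
  exists2 f : T1 -> T2, bijective f & forall x, k2 (f x) = k1 x.
Proof.
move=> i1 i2 h12 h21; exists (fun x => xchoose (h12 x)); last first.
  by move=> x; apply/eqP; apply: (xchooseP (h12 x)).
exists (fun y => xchoose (h21 y)) => [x|y].
  by apply: i1; rewrite (eqP (xchooseP (h21 _))) (eqP (xchooseP (h12 _))).
by apply: i2; rewrite (eqP (xchooseP (h12 _))) (eqP (xchooseP (h21 _))).
Qed.

(** * Drawings of the glued graph: the lattice drawing and the obstruction to any drawing *)

Section Embedding.
Variable K : rcfType.

Definition embed (v : int * int) : K * K :=
  (v.1%:~R + v.2%:~R / 2, Num.sqrt 3 / 2 * v.2%:~R).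

Lemma sqdist_embed u v : sqdist (embed u) (embed v) = (norm_form (u - v))%:~R.
Proof.
case: u v => [a b] [c d]; rewrite /sqdist /norm_form /embed /=.
rewrite !rmorphD !rmorphXn !rmorphM !rmorphB /=.
rewrite -mulrBr exprMn expr_div_n sqr_sqrtr ?ler0n //.
by field.
Qed.

Lemma embed_inj : injective embed.
Proof.
move=> u v e; have := sqdist_embed u v.
rewrite e /sqdist !subrr expr0n addr0 => /esym/eqP; rewrite intr_eq0.
by rewrite norm_form_eq0 subr_eq0 => /eqP.
Qed.

End Embedding.

(** The lattice drawing works: it could only go wrong at two non-special points on different sides,
    by making them coincide or putting them at distance 1. *)
Lemma separated_unit_distance (s t : seq (int * int)) :
  {in s & t, forall u v, u \notin base_edge -> v \notin base_edge ->
    (u != v) && ~~ lattice_adj u v} ->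
  unit_distance (glue (lattice_graph s) (lattice_graph t)).
Proof.
move=> sep; pose p x : R * R := embed R (@key s t x).2.
have sepk x y : (@key s t x).1 -> ~~ (@key s t y).1 -> (key x).2 \notin base_edge ->
    ((key x).2 != (key y).2) && ~~ lattice_adj (key x).2 (key y).2.
  move=> kx ky xb; have yb := key_right ky; apply: sep => //.
    by have := key_mem x; rewrite mem_cat (negPf xb) kx; apply.
  by have := key_mem y; rewrite mem_cat (negPf yb) (negPf ky); apply.
have sepk' x y : (@key s t x).1 -> ~~ (@key s t y).1 -> (key x).2 != (key y).2.
  move=> kx ky; case: (boolP ((key x).2 \in base_edge)) => [xb|/(sepk x y kx ky)/andP[]//].
  by apply: contraNneq (key_right ky) => <-.
exists p; split=> [x y /embed_inj e|x y].
  have [xy|yx] := boolP ((key x).1 == (key y).1).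
    by apply: key_inj; move: (key x) (key y) e (eqP xy) => [a u] [b v] /= -> ->.
  case: (boolP (key x).1) (boolP (key y).1) yx => [kx|kx] [ky|ky] //.
  - by have := sepk' x y kx ky; rewrite e eqxx.
  - by have := sepk' y x ky kx; rewrite e eqxx.
rewrite glue_adj_key -/(sqdist (p x) (p y)) sqrt_sqdist_eq1 sqdist_embed.
rewrite /key_adj.
split=> [/andP[/eqP-> _] //|/eqP].
rewrite (eqr_int R _ 1) -/(lattice_adj _ _) => h; rewrite h /=.
case: (boolP (key x).1) (boolP (key y).1) => [kx|kx] [ky|ky] //=.
- by apply: contraT => /(sepk x y kx ky); rewrite h andbF.
- by apply: contraT => /(sepk y x ky kx); rewrite lattice_adj_sym h andbF.
Qed.

(** Any drawing places the two forced points at a difference equal to the image of the edge from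
    [(0, 0)] to [(0, 1)], hence at distance 1, although they are not adjacent in the gluing. *)
Lemma forced_conflict (s t : seq (int * int)) (x y : int) :
  (0, 1) \in s -> (1, -1) \in t ->
  forced (base_edge ++ s) (0, 1) (x, y + 1) ->
  forced (base_edge ++ t) (1, -1) (x, y) ->
  (x, y + 1) \notin base_edge -> (x, y) \notin base_edge ->
  ~ unit_distance (glue (lattice_graph s) (lattice_graph t)).
Proof.
move=> s1 t1 fu fv ub vb [p [pinj padj]].
have padj1 a b : lg_adj (glue (lattice_graph s) (lattice_graph t)) a b <->
    sqdist (p a) (p b) = 1 by rewrite -sqrt_sqdist_eq1; exact: padj.
pose P b u := p (@vertex s t b u).
pose pts b := base_edge ++ side_points s t b.
have Pinj b : {in pts b &, injective (P b)}.
  by move=> u w mu mw /pinj /(vertex_inj mu mw).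
have Padj b : {in pts b &, forall u w, lattice_adj u w -> sqdist (P b u) (P b w) = 1}.
  by move=> u w mu mw h; apply/padj1/vertex_adj_lattice.
have m1 : (0, 1) \in pts true by rewrite mem_cat s1 orbT.
have m2 : (1, -1) \in pts false by rewrite mem_cat t1 orbT.
have b0 b : P b (0, 0) = P true (0, 0) by rewrite /P vertex_base.
have b1 b : P b (1, 0) = P true (1, 0) by rewrite /P vertex_base.
pose e := P true (1, 0) - P true (0, 0).
pose f := P true (0, 1) - P true (0, 0).
(* Both apexes complete the special edge to a unit triangle and are distinct,
   so they are mirror images: the two sides lie on opposite sides of the edge. *)
have apex : P false (1, -1) = P true (0, 0) + P true (1, 0) - P true (0, 1).
  apply: unit_triangle_reflection; rewrite ?Padj //.
  - by rewrite -(b0 false) Padj.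
  - by rewrite -(b1 false) Padj.
  - apply/eqP => /pinj /(congr1 (@key s t)).
    by rewrite !key_vertex.
have Pu : P true (x, y + 1) = P true (0, 0) + e *~ x + f *~ (y + 1).
  apply: (forced_affine _ _ m1 (Pinj true) (Padj true) _ _ fu) => //.
    by rewrite /e addrC subrK.
  by rewrite /= mulr1z mulr0z addr0 /f addrC subrK.
(* By [apex], the right apex is drawn at [e - f] from the origin, so the right side is spanned by
   the same frame as the left. *)
have Pv : P false (x, y) = P true (0, 0) + e *~ x + f *~ y.
  rewrite -(b0 false).
  apply: (forced_affine _ _ m2 (Pinj false) (Padj false) _ _ fv) => //.
    by rewrite b0 b1 /e addrC subrK.
  by rewrite b0 apex /= mulr1z mulrNz mulr1z /e /f; congr pair => /=; ring.
have : sqdist (P true (x, y + 1)) (P false (x, y)) = 1.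
  have <- : sqdist (P true (0, 1)) (P true (0, 0)) = 1 by apply: Padj.
  rewrite Pu Pv /sqdist /= mulrzDr mulr1z /=.
  by congr (_ ^+ 2 + _ ^+ 2); ring.
have mu : (x, y + 1) \in pts true by apply: (forced_mem _ _ m1 fu).
have mv : (x, y) \in pts false by apply: (forced_mem _ _ m2 fv).
move/padj1; rewrite glue_adj_key !key_vertex //.
by rewrite /key_adj /= (negPf ub) (negPf vb) andbF.
Qed.

(** * The closed neighborhood of the special edge *)

Lemma glue_NS_iso (s t s' t' : seq (int * int)) (NS : seq (bool * (int * int))) :
  (forall x, (x \in closedNS (glue (lattice_graph s) (lattice_graph t))) =
     (key x \in NS)) ->
  (forall x, (x \in closedNS (glue (lattice_graph s') (lattice_graph t'))) =
     (key x \in NS)) ->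
  (forall k, k \in NS -> exists x, @key s t x == k) ->
  (forall k, k \in NS -> exists x, @key s' t' x == k) ->
  NS_iso (glue (lattice_graph s) (lattice_graph t))
         (glue (lattice_graph s') (lattice_graph t')).
Proof.
move=> c1 c2 e1 e2; set G1 := glue _ (lattice_graph t); set G2 := glue _ _.
pose k1 (x : {x : lg_V G1 | x \in closedNS G1}) := key (val x).
pose k2 (x : {x : lg_V G2 | x \in closedNS G2}) := key (val x).
have i1 : injective k1 by move=> x y /key_inj/val_inj.
have i2 : injective k2 by move=> x y /key_inj/val_inj.
(* The isomorphism matches equal keys; adjacency and the special labels depend on keys alone. *)
have [||f fb fk] := key_bijection i1 i2.
- move=> x; have kx : k1 x \in NS by rewrite -c1; apply: valP.
  have [y yk] := e2 _ kx.
  have ym : y \in closedNS G2 by rewrite c2 (eqP yk).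
  by exists (exist _ y ym).
- move=> x; have kx : k2 x \in NS by rewrite -c2; apply: valP.
  have [y yk] := e1 _ kx.
  have ym : y \in closedNS G1 by rewrite c1 (eqP yk).
  by exists (exist _ y ym).
exists f; split=> // [x y|i x xi].
  by rewrite !glue_adj_key -!/(k1 _) -!/(k2 _) !fk.
by apply: key_inj; rewrite -/(k2 _) fk /k1 xi.
Qed.

Lemma closedNS_key (s t : seq (int * int)) x :
  (x \in closedNS (glue (lattice_graph s) (lattice_graph t))) =
  ((key x).2 \in base_edge) || has (lattice_adj (key x).2) base_edge.
Proof.
set G := glue _ _.
have adjE (i : 'I_2) : lg_adj G x (lg_lab G i) = lattice_adj (key x).2 ((i : nat)%:Z, 0).
  rewrite glue_adj_key /key_adj /=; case: (key x).1; rewrite /= ?andbT //.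
  by case: i => [[|[|i]]] //= _; rewrite andbT.
have labE (i : 'I_2) : key (lg_lab G i) = (true, ((i : nat)%:Z, 0)) by [].
have inbase (i : 'I_2) : ((i : nat)%:Z, 0) \in base_edge by case: i => [[|[|i]]].
rewrite inE -[LHS]/((x \in codom (lg_lab G)) || [exists i, lg_adj G x (lg_lab G i)]).
apply/orP/orP => -[h|h].
- by case/codomP: h => i ->; left; rewrite labE inbase.
- case/existsP: h => i; rewrite adjE => h.
  by right; apply/hasP; exists ((i : nat)%:Z, 0).
- left; have k1 : (key x).1 by apply: contraTT h => /key_right.
  move: h; rewrite !inE => /orP[] /eqP e.
    have -> : x = lg_lab G ord0 by apply: key_inj; move: k1 e; case: (key x) => [[] v] //= _ ->.
    exact: codom_f.
  have -> : x = lg_lab G ord_max by apply: key_inj; move: k1 e; case: (key x) => [[] v] //= _ ->.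
  exact: codom_f.
- right; apply/existsP; move: h => /= /or3P[h|h|//].
    by exists ord0; apply: etrans (adjE ord0) h.
  by exists ord_max; apply: etrans (adjE ord_max) h.
Qed.

(** * The strips with flags encoding [A] and [B] *)

Section Construction.
Variable N : nat.
Implicit Types A B : {set 'I_N}.

(* The left side lies above the special edge and reaches down to height 1
   with the flags (3i + 3, 1); the right side lies below and reaches up to
   height 0 with the flags (3j + 3, 0). The points at height 2 and 3, resp. -1
   and -2, make up rigid strips carrying the flags. *)
Definition left_points A : seq (int * int) :=
  [:: (0, 1); (1, 1)] ++ [seq (Posz x, 2) | x <- iota 0 (3 * N).+1]
  ++ [seq (Posz x, 3) | x <- iota 0 (3 * N)]
  ++ [seq (Posz (3 * i + 3), 1) | i : 'I_N <- enum A].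

Definition right_points B : seq (int * int) :=
  [seq (Posz x.+1, -1) | x <- iota 0 (3 * N).+1]
  ++ [seq (Posz x.+2, -2) | x <- iota 0 (3 * N)]
  ++ [seq (Posz (3 * i + 3), 0) | i : 'I_N <- enum B].

Variant left_spec A : int * int -> Prop :=
| LeftApex : left_spec A (0, 1)
| LeftSecond : left_spec A (1, 1)
| LeftRow2 (x : nat) of (x <= 3 * N)%N : left_spec A (Posz x, 2)
| LeftRow3 (x : nat) of (x < 3 * N)%N : left_spec A (Posz x, 3)
| LeftFlag (i : 'I_N) of i \in A : left_spec A (Posz (3 * i + 3), 1).

Variant right_spec B : int * int -> Prop :=
| RightRow1 (x : nat) of (x <= 3 * N)%N : right_spec B (Posz x.+1, -1)
| RightRow2 (x : nat) of (x < 3 * N)%N : right_spec B (Posz x.+2, -2)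
| RightFlag (i : 'I_N) of i \in B : right_spec B (Posz (3 * i + 3), 0).

Lemma left_pointsP A v : v \in left_points A <-> left_spec A v.
Proof.
rewrite /left_points !mem_cat; split=> [|[||x h|x h|i h]].
- case/or4P => [|/mapP[x]|/mapP[x]|/mapP[i]].
  + by rewrite !inE => /orP[] /eqP ->; constructor.
  + by rewrite mem_iota => ? ->; constructor.
  + by rewrite mem_iota => ? ->; constructor.
  + by rewrite mem_enum => ? ->; constructor.
- by rewrite !inE eqxx.
- by rewrite !inE eqxx orbT.
- by apply/or4P/Or42/map_f; rewrite mem_iota.
- by apply/or4P/Or43/map_f; rewrite mem_iota.
- by apply/or4P/Or44/mapP; exists i; rewrite ?mem_enum.
Qed.

Lemma right_pointsP B v : v \in right_points B <-> right_spec B v.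
Proof.
rewrite /right_points !mem_cat; split=> [|[x h|x h|i h]].
- case/or3P => /mapP[x].
  + by rewrite mem_iota => ? ->; constructor.
  + by rewrite mem_iota => ? ->; constructor.
  + by rewrite mem_enum => ? ->; constructor.
- by apply/or3P/Or31/map_f; rewrite mem_iota.
- by apply/or3P/Or32/map_f; rewrite mem_iota.
- by apply/or3P/Or33/mapP; exists i; rewrite ?mem_enum.
Qed.

Lemma size_left_points A : (size (left_points A) <= 7 * N + 3)%N.
Proof.
rewrite /left_points !size_cat !size_map !size_iota -cardE /=.
have : (#|A| <= N)%N by rewrite -[N in (_ <= N)%N]card_ord max_card.
by move: #|_| => k; lia.
Qed.

Lemma size_right_points B : (size (right_points B) <= 7 * N + 1)%N.
Proof.
rewrite /right_points !size_cat !size_map !size_iota -cardE /=.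
have : (#|B| <= N)%N by rewrite -[N in (_ <= N)%N]card_ord max_card.
by move: #|_| => k; lia.
Qed.

(** Flags start at abscissa 3, too far from the special edge to occur here, so the list is the same
    for all [A] and [B]. *)
Definition special_neighborhood : seq (bool * (int * int)) :=
  [:: (true, (0, 0)); (true, (1, 0)); (true, (0, 1)); (true, (1, 1));
      (false, (1, -1)); (false, (2, -1))].

Tactic Notation "forced_step" uconstr(w') uconstr(u') uconstr(v') :=
  refine (@ForcedStep _ _ w' u' v' _ _ _ _ _ _ _ _ _ _);
  first [ done
        | by apply/eqP; rewrite /norm_form /=; lia
        | by congr pair => /=; lia
        | by rewrite xpair_eqE /=; lia
        | idtac ].

Lemma left_forced A v :
  v \in left_points A -> forced (base_edge ++ left_points A) (0, 1) v.
Proof.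
set F := forced _ _.
have mem u : left_spec A u -> u \in base_edge ++ left_points A.
  by move=> h; rewrite mem_cat; apply/orP; right; apply/left_pointsP.
have f0 : F (0, 0) by apply: Forced0.
have f1 : F (1, 0) by apply: Forced1.
have fc : F (0, 1) by apply: ForcedApex.
have fd : F (1, 1) by forced_step (0, 0) (1, 0) (0, 1); apply/mem; constructor.
have fe : F (0, 2).
  by forced_step (1, 0) (0, 1) (1, 1); apply/mem; apply: (@LeftRow2 _ 0).
(* The induction carries a whole triangle of the strip; two reflections move it one step to the
   right. *)
have strip x : (x < 3 * N)%N -> [/\ F (Posz x, 2), F (Posz x.+1, 2) & F (Posz x, 3)].
  elim: x => [|x IH] h.
    have fe' : F (1, 2).
      by forced_step (0, 1) (1, 1) (0, 2); apply/mem; apply: (@LeftRow2 _ 1).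
    split=> //.
    by forced_step (1, 1) (0, 2) (1, 2); apply/mem; apply: (@LeftRow3 _ 0).
  have [a b d] := IH (ltnW h).
  have e : F (Posz x.+1, 3).
    by forced_step (Posz x, 2) (Posz x.+1, 2) (Posz x, 3); apply/mem; constructor.
  split=> //.
  by forced_step (Posz x, 3) (Posz x.+1, 2) (Posz x.+1, 3); apply/mem; constructor.
move/left_pointsP => [||x h|x h|i iA] //.
- case: x h => [//|x h].
  by have [] := strip x h.
- by have [] := strip x h.
(* The flag is the reflection of the strip point [(3i + 2, 3)] in the edge below it. The last flag
   uses the triangle at [3N - 1], which fixes the length of the strip. *)
have h : (3 * i + 2 < 3 * N)%N by have := ltn_ord i; lia.
have [a b d] := strip _ h.
forced_step (Posz (3 * i + 2), 3) (Posz (3 * i + 2), 2) (Posz (3 * i + 2).+1, 2).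
by apply/mem; constructor.
Qed.

Lemma right_forced B v :
  v \in right_points B -> forced (base_edge ++ right_points B) (1, -1) v.
Proof.
set F := forced _ _.
have mem u : right_spec B u -> u \in base_edge ++ right_points B.
  by move=> h; rewrite mem_cat; apply/orP; right; apply/right_pointsP.
have f0 : F (0, 0) by apply: Forced0.
have f1 : F (1, 0) by apply: Forced1.
have fc : F (1, -1) by apply: ForcedApex.
have strip x : (x < 3 * N)%N -> [/\ F (Posz x.+1, -1), F (Posz x.+2, -1) & F (Posz x.+2, -2)].
  elim: x => [|x IH] h.
    have fd : F (2, -1).
      by forced_step (0, 0) (1, 0) (1, -1); apply/mem; apply: (@RightRow1 _ 1).
    split=> //.
    by forced_step (1, 0) (1, -1) (2, -1); apply/mem; apply: (@RightRow2 _ 0).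
  have [a b d] := IH (ltnW h).
  have e : F (Posz x.+3, -2).
    by forced_step (Posz x.+1, -1) (Posz x.+2, -1) (Posz x.+2, -2); apply/mem; constructor.
  split=> //.
  by forced_step (Posz x.+2, -2) (Posz x.+2, -1) (Posz x.+3, -2); apply/mem; constructor.
move/right_pointsP => [x h|x h|i iB] //.
- case: x h => [//|x h].
  by have [] := strip x h.
- by have [] := strip x h.
(* The flag is the reflection of [(3i + 4, -2)] in the edge from [(3i + 3, -1)] to
   [(3i + 4, -1)]. *)
have h : (3 * i + 2 < 3 * N)%N by have := ltn_ord i; lia.
have [a b d] := strip _ h.
forced_step (Posz (3 * i + 2).+2, -2) (Posz (3 * i + 2).+1, -1) (Posz (3 * i + 2).+2, -1).
by apply/mem; constructor.
Qed.

Lemma apex_left A : (0, 1) \in left_points A.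
Proof. by apply/left_pointsP; constructor. Qed.

Lemma apex_right B : (1, -1) \in right_points B.
Proof. by apply/right_pointsP; apply: (@RightRow1 _ 0). Qed.

Notation G A B := (glue (lattice_graph (left_points A)) (lattice_graph (right_points B))).

Lemma closedNS_special A B (x : lg_V (G A B)) :
  (x \in closedNS (G A B)) = (key x \in special_neighborhood).
Proof.
rewrite closedNS_key; have := key_mem x; have := @key_right _ _ x.
rewrite mem_cat; case: (key x) => [[] v] /= => [_|/(_ isT) vb]; last rewrite (negPf vb) orFb.
  case/orP => [|/left_pointsP[||y h|y h|i iA]] //.
  - by rewrite !inE => /orP[] /eqP ->.
  - by rewrite !lattice_adjE !inE !xpair_eqE /=; lia.
  - by rewrite !lattice_adjE !inE !xpair_eqE /=; lia.
  - by rewrite !lattice_adjE !inE !xpair_eqE /=; lia.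
move=> /right_pointsP v_right; case: v_right vb => [y h|y h|i iB].
- by rewrite !lattice_adjE !inE !xpair_eqE /=; lia.
- by rewrite !lattice_adjE !inE !xpair_eqE /=; lia.
- by rewrite !lattice_adjE !inE !xpair_eqE /=; lia.
Qed.

Lemma special_key A B k : (0 < N)%N -> k \in special_neighborhood ->
  exists x, @key (left_points A) (right_points B) x == k.
Proof.
move=> N0 kN.
have mR u : right_spec B u -> u \in base_edge ++ right_points B.
  by move=> h; rewrite mem_cat; apply/orP; right; apply/right_pointsP.
have mk : k.2 \in base_edge ++ side_points (left_points A) (right_points B) k.1.
  rewrite !inE in kN; case/or4P: kN => [/eqP->|/eqP->|/eqP->|/or3P[]/eqP->] //.
  (* Positivity of [N] makes the upper right-hand row long enough to contain [(2, -1)]. *)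
  by apply: (mR (2, -1)); apply: (@RightRow1 _ 1); lia.
exists (vertex _ _ k.1 k.2); rewrite key_vertex //.
by move: kN; rewrite !inE => /or4P[/eqP->|/eqP->|/eqP->|/or3P[]/eqP->].
Qed.

Lemma card_closedNS A B : (#|closedNS (G A B)| <= 6)%N.
Proof.
rewrite cardE -(size_map (@key _ _)).
apply: (@uniq_leq_size _ _ special_neighborhood); first by rewrite map_inj_uniq ?enum_uniq //; apply: key_inj.
by move=> k /mapP[x]; rewrite mem_enum closedNS_special => xs ->.
Qed.

Lemma connected_glue A B : connected (G A B).
Proof.
apply: (@glue_connected _ _ (fun b => if b then (0, 1) else (1, -1))) => -[] //.
- exact: left_forced.
- exact: right_forced.
Qed.

Lemma unit_distance_disjoint A B : unit_distance (G A B) <-> A :&: B = set0.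
Proof.
split=> [ud|/setP AB].
  apply/setP => i; rewrite !inE; apply/negP => /andP[iA iB].
  move: ud; apply: (@forced_conflict _ _ (Posz (3 * i + 3)) 0).
  - exact: apex_left.
  - exact: apex_right.
  - by apply: left_forced; apply/left_pointsP; constructor.
  - by apply: right_forced; apply/right_pointsP; constructor.
  - by rewrite !inE !xpair_eqE /=; lia.
  - by rewrite !inE !xpair_eqE /=; lia.
apply: separated_unit_distance => u v /left_pointsP uL /right_pointsP vR _ _.
(* Heights differ by at least 2 unless the left point has height 1 and the right one is a flag. Two
   flags differ by [(3(i - j), 1)], a lattice unit only for [i = j]. *)
case: uL vR => [||x hx|x hx|i iA] [y hy|y hy|j jB];
  rewrite lattice_adjE ?inE !xpair_eqE /=; try lia.
have ij : (i : nat) <> j.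
  by move/val_inj => ij; have := AB i; rewrite !inE iA ij jB.
lia.
Qed.

End Construction.

Theorem theorem5p3 :
  disjointness_expressing (fun k (G : lgraph k) => unit_distance G) 6 1.
Proof.
(* The vertex count is at most [(7N + 3) + (7N + 1) + 4 = 14N + 8], hence at most [22N] for positive
   [N]. *)
exists 22%:R; split; first by rewrite ltr0n.
exists (fun=> 2), (fun N A => lattice_graph (left_points A)),
  (fun N B => lattice_graph (right_points B)) => N N0; split=> [A B|A B A' B'|A B|A B].
- split; first exact: connected_glue.
  rewrite (_ : Rpower _ _ = N%:R); last first.
    by rewrite invr1; apply: Rpower_1; apply/RltP; rewrite ltr0n.
  rewrite -natrM ler_nat; apply: leq_trans (card_glue _ _) _.
  have := size_left_points A; have := size_right_points B; lia.
- by apply: glue_NS_iso => *; rewrite ?closedNS_special //; apply: special_key.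
- exact: card_closedNS.
- exact: unit_distance_disjoint.
Qed.
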